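(* Let $\mathsf{C}$ be a partializable Markov category. Then: (1) $\mathsf{Partial}(\mathsf{C})$ is a quasi-Markov category. (2) The two partial orders on hom-sets of $\mathsf{Partial}(\mathsf{C})$ agree: for parallel morphisms $u,v\colon X\to Y$ of $\mathsf{Partial}(\mathsf{C})$, $u\sqsupseteq v$ (the extension order) if and only if $u\ge v$ (the span order). (3) The two notions of totality agree: a morphism of $\mathsf{Partial}(\mathsf{C})$ is total (commutes with deletion) if and only if it is in the image of the inclusion $\mathsf{C}\hookrightarrow\mathsf{Partial}(\mathsf{C})$.
   Context: A CD category is a symmetric monoidal category $(\mathsf{C},\otimes,I)$ in which every object $X$ carries a commutative comonoid structure $\mathrm{copy}_X\colon X\to X\otimes X$, $\mathrm{del}_X\colon X\to I$, compatible with tensor products ($\mathrm{copy}_{X\otimes Y}$ is $\mathrm{copy}_X\otimes\mathrm{copy}_Y$ followed by swapping the two middle factors, and $\mathrm{del}_{X\otimes Y}=\mathrm{del}_X\otimes\mathrm{del}_Y$) and with $\mathrm{copy}_I=\mathrm{del}_I=\mathrm{id}_I$; coherence isomorphisms are suppressed. A morphism $f\colon X\to Y$ is total if $\mathrm{del}_Y\circ f=\mathrm{del}_X$, copyable if $\mathrm{copy}_Y\circ f=(f\otimes f)\circ\mathrm{copy}_X$, deterministic if it is both, and quasi-total if $(f\otimes(\mathrm{del}_Y\circ f))\circ\mathrm{copy}_X=f$. A Markov category is a CD category in which every morphism is total; a quasi-Markov category is a CD category in which every morphism is quasi-total. A Markov category is positive if for all $u\colon X\to Y$, $v\colon Y\to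 Z$ with $v\circ u$ deterministic, $(u\otimes (v\circ u))\circ\mathrm{copy}_X=(\mathrm{id}_Y\otimes v)\circ\mathrm{copy}_Y\circ u$. Extension order: for parallel morphisms $f,g\colon A\to X$ of a quasi-Markov category, $f\sqsupseteq g$ means $(f\otimes(\mathrm{del}_X\circ g))\circ\mathrm{copy}_A=g$. A Markov category $\mathsf{C}$ is partializable if: (i) it is positive; (ii) pullbacks of deterministic monomorphisms along arbitrary morphisms exist and are themselves deterministic (monomorphisms); (iii) if $i\colon D\to X$ is a deterministic monomorphism then $i\otimes\mathrm{id}_A$ is a monomorphism for every object $A$. For $\mathsf{C}$ partializable, the CD category $\mathsf{Partial}(\mathsf{C})$ has the objects of $\mathsf{C}$; its morphisms $X\to Y$ are equivalence classes of spans $X\xleftarrow{i}D\xrightarrow{f}Y$ (also written $(D,i,f)$) in $\mathsf{C}$ with $i$ a deterministic monomorphism, where $(D,i,f)\sim(D',i',f')$ iff there is an isomorphism $t\colon D\to D'$ with $i'\circ t=i$, $f'\circ t=f$. The composite of $(A,i,f)\colon X\to Y$ followed by $(B,j,g)\colon Y\to Z$ is $(C,i\circ u,g\circ v)$, where $A\xleftarrow{u}C\xrightarrow{v}B$ is the pullback of $f$ and $j$. The inclusion $\mathsf{C}\hookrightarrow\mathsf{Partial}(\mathsf{C})$ sends $f\colon X\to Y$ to $(X,\mathrm{id}_X,f)$. The tensor product is componentwise, $(A,i,f)\otimes(B,j,g)=(A\otimes B,i\otimes j,f\otimes g)$, and the copy and delete maps (and coherence isomorphisms) are the images of those of $\mathsf{C}$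 under the inclusion. Span order: for parallel morphisms of $\mathsf{Partial}(\mathsf{C})$, $(A,i,f)\ge(B,j,g)$ iff there is a morphism $t\colon B\to A$ in $\mathsf{C}$ with $i\circ t=j$ and $f\circ t=g$. *)

(* Defs.v *)
From Corelib Require Import ssreflect.
From Stdlib Require Import ClassicalEpsilon FunctionalExtensionality.
From Stdlib Require Import PropExtensionality ProofIrrelevance.

Set Implicit Arguments.
Unset Strict Implicit.
Unset Printing Implicit Defensive.

(* Operations and laws are kept apart: the records ending in [_data] contain
   operations only, and the laws are the predicates [is_category],
   [is_symmetric_monoidal] and [is_cd].  Equality of morphisms is Leibniz
   equality.  Monoidal structures are not assumed strict, so the coherence
   isomorphisms that one usually suppresses are written out. *)

(** * Categories *)

Record category_data := CategoryData {
  ob :> Type;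
  hom : ob -> ob -> Type;
  idm : forall X, hom X X;
  comp : forall X Y Z, hom Y Z -> hom X Y -> hom X Z }.

Arguments hom {c} X Y.
Arguments idm {c} X.
Arguments comp {c X Y Z} g f.

Notation "g ∘ f" := (comp g f) (at level 40, left associativity).

Record is_category (C : category_data) : Prop := IsCategory {
  comp1f : forall (X Y : C) (f : hom X Y), idm Y ∘ f = f;
  compf1 : forall (X Y : C) (f : hom X Y), f ∘ idm X = f;
  compA : forall (W X Y Z : C) (h : hom Y Z) (g : hom X Y) (f : hom W X),
    h ∘ (g ∘ f) = h ∘ g ∘ f }.

Section CategoryNotions.
Context {C : category_data}.

Definition is_iso (X Y : C) (f : hom X Y) : Prop :=
  exists g : hom Y X, g ∘ f = idm X /\ f ∘ g = idm Y.

Definition monomorphism (X Y : C) (f : hom X Y) : Prop :=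
  forall (W : C) (a b : hom W X), f ∘ a = f ∘ b -> a = b.

(* P --v--> B
   |        |
   u        j
   |        |
   A --f--> Y *)
Definition is_pullback (A B Y P : C) (f : hom A Y) (j : hom B Y)
    (u : hom P A) (v : hom P B) : Prop :=
  f ∘ u = j ∘ v /\
  forall (W : C) (a : hom W A) (b : hom W B), f ∘ a = j ∘ b ->
    exists! w : hom W P, u ∘ w = a /\ v ∘ w = b.

End CategoryNotions.

(** * Symmetric monoidal categories *)

Record monoidal_data := MonoidalData {
  mcat :> category_data;
  munit : mcat;
  tens_ob : mcat -> mcat -> mcat;
  tens : forall X X' Y Y' : mcat,
    hom X X' -> hom Y Y' -> hom (tens_ob X Y) (tens_ob X' Y');
  assoc : forall X Y Z : mcat,
    hom (tens_ob (tens_ob X Y) Z) (tens_ob X (tens_ob Y Z));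
  assoc_inv : forall X Y Z : mcat,
    hom (tens_ob X (tens_ob Y Z)) (tens_ob (tens_ob X Y) Z);
  lunit : forall X : mcat, hom (tens_ob munit X) X;
  lunit_inv : forall X : mcat, hom X (tens_ob munit X);
  runit : forall X : mcat, hom (tens_ob X munit) X;
  runit_inv : forall X : mcat, hom X (tens_ob X munit);
  braid : forall X Y : mcat, hom (tens_ob X Y) (tens_ob Y X) }.

Arguments munit {m}.
Arguments tens_ob {m} X Y.
Arguments tens {m X X' Y Y'} f g.
Arguments assoc {m} X Y Z.
Arguments assoc_inv {m} X Y Z.
Arguments lunit {m} X.
Arguments lunit_inv {m} X.
Arguments runit {m} X.
Arguments runit_inv {m} X.
Arguments braid {m} X Y.

Notation "X ⊠ Y" := (tens_ob X Y) (at level 34, left associativity).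
Notation "f ⊗ g" := (tens f g) (at level 36, left associativity).

Record is_symmetric_monoidal (C : monoidal_data) : Prop :=
    IsSymmetricMonoidal {
  sm_category : is_category C;
  tens_id : forall X Y : C, idm X ⊗ idm Y = idm (X ⊠ Y);
  tens_comp : forall (X Y Z X' Y' Z' : C) (g : hom Y Z) (f : hom X Y)
      (g' : hom Y' Z') (f' : hom X' Y'),
    (g ∘ f) ⊗ (g' ∘ f') = (g ⊗ g') ∘ (f ⊗ f');
  assocK : forall X Y Z : C,
    assoc_inv X Y Z ∘ assoc X Y Z = idm (X ⊠ Y ⊠ Z);
  assoc_invK : forall X Y Z : C,
    assoc X Y Z ∘ assoc_inv X Y Z = idm (X ⊠ (Y ⊠ Z));
  lunitK : forall X : C, lunit_inv X ∘ lunit X = idm (munit ⊠ X);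
  lunit_invK : forall X : C, lunit X ∘ lunit_inv X = idm X;
  runitK : forall X : C, runit_inv X ∘ runit X = idm (X ⊠ munit);
  runit_invK : forall X : C, runit X ∘ runit_inv X = idm X;
  assoc_nat : forall (X X' Y Y' Z Z' : C)
      (f : hom X X') (g : hom Y Y') (h : hom Z Z'),
    assoc X' Y' Z' ∘ ((f ⊗ g) ⊗ h) = (f ⊗ (g ⊗ h)) ∘ assoc X Y Z;
  lunit_nat : forall (X Y : C) (f : hom X Y),
    lunit Y ∘ (idm munit ⊗ f) = f ∘ lunit X;
  runit_nat : forall (X Y : C) (f : hom X Y),
    runit Y ∘ (f ⊗ idm munit) = f ∘ runit X;
  braid_nat : forall (X X' Y Y' : C) (f : hom X X') (g : hom Y Y'),
    braid X' Y' ∘ (f ⊗ g) = (g ⊗ f) ∘ braid X Y;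
  braidK : forall X Y : C, braid Y X ∘ braid X Y = idm (X ⊠ Y);
  triangle : forall X Y : C,
    (idm X ⊗ lunit Y) ∘ assoc X munit Y = runit X ⊗ idm Y;
  pentagon : forall W X Y Z : C,
    (idm W ⊗ assoc X Y Z) ∘ assoc W (X ⊠ Y) Z ∘ (assoc W X Y ⊗ idm Z)
    = assoc W X (Y ⊠ Z) ∘ assoc (W ⊠ X) Y Z;
  hexagon : forall X Y Z : C,
    (idm Y ⊗ braid X Z) ∘ assoc Y X Z ∘ (braid X Y ⊗ idm Z)
    = assoc Y Z X ∘ braid X (Y ⊠ Z) ∘ assoc X Y Z }.

Definition middle_swap {C : monoidal_data} (W X Y Z : C) :
    hom ((W ⊠ X) ⊠ (Y ⊠ Z)) ((W ⊠ Y) ⊠ (X ⊠ Z)) :=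
  assoc_inv W Y (X ⊠ Z)
  ∘ (idm W ⊗ (assoc Y X Z ∘ (braid X Y ⊗ idm Z) ∘ assoc_inv X Y Z))
  ∘ assoc W X (Y ⊠ Z).

(** * CD categories *)

Record cd_data := CDData {
  cd_monoidal :> monoidal_data;
  copy : forall X : cd_monoidal, hom X (X ⊠ X);
  del : forall X : cd_monoidal, hom X munit }.

Arguments copy {c} X.
Arguments del {c} X.

Record is_cd (C : cd_data) : Prop := IsCD {
  cd_symmetric_monoidal : is_symmetric_monoidal C;
  copy_assoc : forall X : C,
    assoc X X X ∘ (copy X ⊗ idm X) ∘ copy X = (idm X ⊗ copy X) ∘ copy X;
  copy_lunit : forall X : C, lunit X ∘ (del X ⊗ idm X) ∘ copy X = idm X;
  copy_runit : forall X : C, runit X ∘ (idm X ⊗ del X) ∘ copy X = idm X;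
  copy_comm : forall X : C, braid X X ∘ copy X = copy X;
  copy_tens : forall X Y : C,
    copy (X ⊠ Y) = middle_swap X X Y Y ∘ (copy X ⊗ copy Y);
  del_tens : forall X Y : C,
    del (X ⊠ Y) = lunit munit ∘ (del X ⊗ del Y);
  copy_unit : copy (@munit C) = lunit_inv munit;
  del_unit : del (@munit C) = idm munit }.

Section CDNotions.
Context {C : cd_data}.

Definition total (X Y : C) (f : hom X Y) : Prop := del Y ∘ f = del X.

Definition copyable (X Y : C) (f : hom X Y) : Prop :=
  copy Y ∘ f = (f ⊗ f) ∘ copy X.

Definition deterministic (X Y : C) (f : hom X Y) : Prop :=
  total f /\ copyable f.

Definition quasi_total (X Y : C) (f : hom X Y) : Prop :=
  runit Y ∘ (f ⊗ (del Y ∘ f)) ∘ copy X = f.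

(* [extends f g] is f ⊒ g. *)
Definition extends (A X : C) (f g : hom A X) : Prop :=
  runit X ∘ (f ⊗ (del X ∘ g)) ∘ copy A = g.

Definition det_mono (X Y : C) (f : hom X Y) : Prop :=
  deterministic f /\ monomorphism f.

End CDNotions.

Definition is_markov (C : cd_data) : Prop :=
  is_cd C /\ forall (X Y : C) (f : hom X Y), total f.

Definition is_quasi_markov (C : cd_data) : Prop :=
  is_cd C /\ forall (X Y : C) (f : hom X Y), quasi_total f.

Definition positive (C : cd_data) : Prop :=
  forall (X Y Z : C) (u : hom X Y) (v : hom Y Z), deterministic (v ∘ u) ->
    (u ⊗ (v ∘ u)) ∘ copy X = (idm Y ⊗ v) ∘ copy Y ∘ u.

Record partializable (C : cd_data) : Prop := Partializable {
  pz_markov : is_markov C;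
  pz_positive : positive C;
  pz_pullback : forall (A B Y : C) (f : hom A Y) (j : hom B Y), det_mono j ->
    exists (P : C) (u : hom P A) (v : hom P B), is_pullback f j u v;
  pz_pullback_det_mono : forall (A B Y P : C) (f : hom A Y) (j : hom B Y)
      (u : hom P A) (v : hom P B),
    det_mono j -> is_pullback f j u v -> det_mono u;
  pz_tens_mono : forall (D X A : C) (i : hom D X),
    det_mono i -> monomorphism (i ⊗ idm A) }.

(** * Closure properties of deterministic monomorphisms *)

Section DetMono.
Context {C : cd_data} (hC : partializable C).

Let cdC : is_cd C := proj1 (pz_markov hC).
Let smC : is_symmetric_monoidal C := cd_symmetric_monoidal cdC.
Let catC : is_category C := sm_category smC.

Lemma det_mono_id (X : C) : det_mono (idm X).
Proof.
split; first split.
- exact: (compf1 catC).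
- by rewrite /copyable (tens_id smC) (comp1f catC) (compf1 catC).
- by move=> W a b; rewrite !(comp1f catC).
Qed.

Lemma det_mono_comp (X Y Z : C) (g : hom Y Z) (f : hom X Y) :
  det_mono g -> det_mono f -> det_mono (g ∘ f).
Proof.
move=> [[_ cg] mg] [[_ cf] mf]; split; first split.
- exact: (proj2 (pz_markov hC)).
- rewrite /copyable (compA catC) cg -(compA catC) cf (compA catC).
  by rewrite -(tens_comp smC).
- by move=> W a b; rewrite -!(compA catC) => /mg /mf.
Qed.

Lemma assoc_inv_nat (X X' Y Y' Z Z' : C)
    (f : hom X X') (g : hom Y Y') (h : hom Z Z') :
  assoc_inv X' Y' Z' ∘ (f ⊗ (g ⊗ h)) = ((f ⊗ g) ⊗ h) ∘ assoc_inv X Y Z.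
Proof.
rewrite -[f ⊗ (g ⊗ h)](compf1 catC) -(assoc_invK smC) (compA catC (f ⊗ (g ⊗ h))).
by rewrite -(assoc_nat smC) !(compA catC) (assocK smC) (comp1f catC).
Qed.

Lemma middle_swap_nat (W W' X X' Y Y' Z Z' : C) (e : hom W W') (f : hom X X')
    (g : hom Y Y') (h : hom Z Z') :
  middle_swap W' X' Y' Z' ∘ ((e ⊗ f) ⊗ (g ⊗ h))
  = ((e ⊗ g) ⊗ (f ⊗ h)) ∘ middle_swap W X Y Z.
Proof.
rewrite /middle_swap -(compA catC) (assoc_nat smC) !(compA catC).
congr (_ ∘ _); rewrite -(compA catC) -(tens_comp smC) (comp1f catC).
rewrite -(compA catC _ _ (f ⊗ (g ⊗ h))) assoc_inv_nat (compA catC).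
rewrite -(compA catC _ _ ((f ⊗ g) ⊗ h)) -(tens_comp smC) (braid_nat smC).
rewrite (comp1f catC) -[h in (_ ∘ _) ⊗ h](compf1 catC) (tens_comp smC).
rewrite (compA catC) (assoc_nat smC) -!(compA catC).
rewrite -[e in e ⊗ _](compf1 catC) (tens_comp smC) (compA catC).
by rewrite assoc_inv_nat -(compA catC).
Qed.

Lemma det_mono_tens (X X' Y Y' : C) (i : hom X X') (j : hom Y Y') :
  det_mono i -> det_mono j -> det_mono (i ⊗ j).
Proof.
move=> di dj; split; first split.
- exact: (proj2 (pz_markov hC)).
- move: di dj => [[_ ci] _] [[_ cj] _].
  rewrite /copyable !(copy_tens cdC) -(compA catC) -(tens_comp smC) ci cj.
  by rewrite (tens_comp smC) (compA catC) middle_swap_nat (compA catC).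
- have mj : monomorphism (idm X ⊗ j).
    move=> W a b /(f_equal (comp (braid X Y'))).
    rewrite !(compA catC) !(braid_nat smC) -!(compA catC).
    move=> /(pz_tens_mono hC dj) /(f_equal (comp (braid Y X))).
    by rewrite !(compA catC) (braidK smC) !(comp1f catC).
  have -> : i ⊗ j = (i ⊗ idm Y') ∘ (idm X ⊗ j).
    by rewrite -(tens_comp smC) (compf1 catC) (comp1f catC).
  by move=> W a b; rewrite -!(compA catC) => /(pz_tens_mono hC di) /mj.
Qed.

End DetMono.

(** * Partial maps *)

Record span {C : cd_data} (X Y : C) := Span {
  apex : C;
  leg : hom apex X;
  mor : hom apex Y;
  leg_det_mono : det_mono leg }.

Arguments Span {C X Y} apex leg mor leg_det_mono.

Section Span.
Context {C : cd_data}.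

Definition span_equiv (X Y : C) (s s' : span X Y) : Prop :=
  exists t : hom (apex s) (apex s'),
    is_iso t /\ leg s' ∘ t = leg s /\ mor s' ∘ t = mor s.

Definition partial_hom (X Y : C) : Type :=
  {c : span X Y -> Prop | exists s, c = span_equiv s}.

Definition span_class (X Y : C) (s : span X Y) : partial_hom X Y :=
  exist _ (span_equiv s) (ex_intro _ s eq_refl).

Definition span_repr (X Y : C) (c : partial_hom X Y) : span X Y :=
  proj1_sig (constructive_indefinite_description _ (proj2_sig c)).

Lemma span_reprK (X Y : C) (c : partial_hom X Y) :
  span_class (span_repr c) = c.
Proof.
apply: eq_sig_hprop => [c0|]; first exact: proof_irrelevance.
by rewrite /= /span_repr; case: constructive_indefinite_description.
Qed.

Definition span_le_rep (X Y : C) (s s' : span X Y) : Prop :=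
  exists t : hom (apex s) (apex s'), leg s' ∘ t = leg s /\ mor s' ∘ t = mor s.

Definition span_ge (X Y : C) (u v : partial_hom X Y) : Prop :=
  exists s s' : span X Y,
    u = span_class s /\ v = span_class s' /\ span_le_rep s' s.

End Span.

Section Partial.
Context {C : cd_data} (hC : partializable C).

Definition span_comp_of (X Y Z : C) (s : span X Y) (r : span Y Z) (P : C)
    (u : hom P (apex s)) (v : hom P (apex r))
    (uv : is_pullback (mor s) (leg r) u v) : span X Z :=
  Span P (leg s ∘ u) (mor r ∘ v)
    (det_mono_comp hC (leg_det_mono s)
      (pz_pullback_det_mono hC (leg_det_mono r) uv)).

Lemma span_comp_exists (X Y Z : C) (r : span Y Z) (s : span X Y) :
  exists q : span X Z, exists P u v uv, q = @span_comp_of X Y Z s r P u v uv.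
Proof.
have [P [u [v uv]]] := pz_pullback hC (mor s) (leg_det_mono r).
by exists (span_comp_of uv), P, u, v, uv.
Qed.

(* The pullback and, below, the representatives of the two classes are chosen
   arbitrarily; [partial_compE] shows that the choices do not matter. *)
Definition span_comp (X Y Z : C) (r : span Y Z) (s : span X Y) : span X Z :=
  proj1_sig (constructive_indefinite_description _ (span_comp_exists r s)).

Definition span_tens (X X' Y Y' : C) (s : span X X') (r : span Y Y') :
    span (X ⊠ Y) (X' ⊠ Y') :=
  Span (apex s ⊠ apex r) (leg s ⊗ leg r) (mor s ⊗ mor r)
    (det_mono_tens hC (leg_det_mono s) (leg_det_mono r)).

Definition partial_incl (X Y : C) (f : hom X Y) : partial_hom X Y :=
  span_class (Span X (idm X) f (det_mono_id hC X)).

Definition partial_comp (X Y Z : C) (r : partial_hom Y Z)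
    (s : partial_hom X Y) : partial_hom X Z :=
  span_class (span_comp (span_repr r) (span_repr s)).

Definition partial_tens (X X' Y Y' : C) (s : partial_hom X X')
    (r : partial_hom Y Y') : partial_hom (X ⊠ Y) (X' ⊠ Y') :=
  span_class (span_tens (span_repr s) (span_repr r)).

Definition Partial_category : category_data :=
  {| ob := C;
     hom := partial_hom;
     idm := fun X => partial_incl (idm X);
     comp := partial_comp |}.

Definition Partial_monoidal : monoidal_data :=
  {| mcat := Partial_category;
     munit := @munit C;
     tens_ob := @tens_ob C;
     tens := partial_tens;
     assoc := fun X Y Z => partial_incl (assoc X Y Z);
     assoc_inv := fun X Y Z => partial_incl (assoc_inv X Y Z);
     lunit := fun X => partial_incl (lunit X);
     lunit_inv := fun X => partial_incl (lunit_inv X);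
     runit := fun X => partial_incl (runit X);
     runit_inv := fun X => partial_incl (runit_inv X);
     braid := fun X Y => partial_incl (braid X Y) |}.

Definition Partial : cd_data :=
  {| cd_monoidal := Partial_monoidal;
     copy := fun X : C => partial_incl (copy X);
     del := fun X : C => partial_incl (del X) |}.

(** * Independence of the choices *)

Let cdC : is_cd C := proj1 (pz_markov hC).
Let smC : is_symmetric_monoidal C := cd_symmetric_monoidal cdC.
Let catC : is_category C := sm_category smC.

Lemma span_equiv_refl (X Y : C) (s : span X Y) : span_equiv s s.
Proof.
exists (idm _); rewrite !(compf1 catC); split=> //.
by exists (idm _); rewrite (compf1 catC).
Qed.

Lemma span_equiv_sym (X Y : C) (s s' : span X Y) :
  span_equiv s s' -> span_equiv s' s.
Proof.
move=> [t [[t' [t't tt']] [e1 e2]]].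
exists t'; rewrite -e1 -e2; split; first by exists t.
by rewrite -!(compA catC) tt' !(compf1 catC).
Qed.

Lemma span_equiv_trans (X Y : C) (s1 s2 s3 : span X Y) :
  span_equiv s1 s2 -> span_equiv s2 s3 -> span_equiv s1 s3.
Proof.
move=> [t [[t' [t't tt']] [e1 e2]]] [r [[r' [r'r rr']] [e3 e4]]].
exists (r ∘ t); rewrite -e1 -e2 -e3 -e4 !(compA catC); split=> //.
exists (t' ∘ r'); split.
  by rewrite (compA catC) -(compA catC t') r'r (compf1 catC).
by rewrite (compA catC) -(compA catC r) tt' (compf1 catC).
Qed.

Lemma span_classP (X Y : C) (s s' : span X Y) :
  span_class s = span_class s' <-> span_equiv s s'.
Proof.
split=> [/(f_equal (@proj1_sig _ _)) /= ->|e]; first exact: span_equiv_refl.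
apply: eq_sig_hprop => [c0|]; first exact: proof_irrelevance.
apply: functional_extensionality => q; apply: propositional_extensionality.
split; last exact: span_equiv_trans.
exact/span_equiv_trans/span_equiv_sym.
Qed.

Lemma span_class_repr (X Y : C) (s : span X Y) :
  span_equiv (span_repr (span_class s)) s.
Proof. by apply/span_classP; exact: span_reprK. Qed.

(* Mutually comparable spans are equivalent, since their legs are monic. *)
Lemma span_le_antisym (X Y : C) (s s' : span X Y) :
  span_le_rep s s' -> span_le_rep s' s -> span_equiv s s'.
Proof.
move=> [t [ht1 ht2]] [r [hr1 hr2]]; exists t; split=> //.
exists r; split.
  by apply: (proj2 (leg_det_mono s)); rewrite (compA catC) hr1 ht1 (compf1 catC).
by apply: (proj2 (leg_det_mono s')); rewrite (compA catC) ht1 hr1 (compf1 catC).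
Qed.

Lemma span_equiv_le (X Y : C) (s s' : span X Y) :
  span_equiv s s' -> span_le_rep s s'.
Proof. by move=> [t [_ h]]; exists t. Qed.

Lemma span_le_trans (X Y : C) (s1 s2 s3 : span X Y) :
  span_le_rep s1 s2 -> span_le_rep s2 s3 -> span_le_rep s1 s3.
Proof.
move=> [t [e1 e2]] [r [e3 e4]].
by exists (r ∘ t); rewrite -e1 -e2 -e3 -e4 !(compA catC).
Qed.

Lemma span_geE (X Y : C) (s s' : span X Y) :
  span_ge (span_class s) (span_class s') <-> span_le_rep s' s.
Proof.
split=> [[r [r' [/span_classP sr [/span_classP sr' le]]]]|le].
  apply: (span_le_trans (span_equiv_le sr')); apply: (span_le_trans le).
  exact/span_equiv_le/span_equiv_sym.
by exists s, s'.
Qed.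

Lemma span_comp_of_le (X Y Z : C) (s s' : span X Y) (r r' : span Y Z)
    (P P' : C) (u : hom P (apex s)) (v : hom P (apex r))
    (uv : is_pullback (mor s) (leg r) u v)
    (u' : hom P' (apex s')) (v' : hom P' (apex r'))
    (uv' : is_pullback (mor s') (leg r') u' v') :
  span_le_rep s s' -> span_le_rep r r' ->
  span_le_rep (span_comp_of uv) (span_comp_of uv').
Proof.
move=> [t [ht1 ht2]] [k [hk1 hk2]].
have [|w [[hw1 hw2] _]] := proj2 uv' _ (t ∘ u) (k ∘ v).
  by rewrite !(compA catC) ht2 hk1; exact: (proj1 uv).
exists w => /=; rewrite -!(compA catC) hw1 hw2 !(compA catC) ht1 hk2.
by split.
Qed.

Lemma partial_compE (X Y Z : C) (r : span Y Z) (s : span X Y) (P : C)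
    (u : hom P (apex s)) (v : hom P (apex r))
    (uv : is_pullback (mor s) (leg r) u v) :
  partial_comp (span_class r) (span_class s) = span_class (span_comp_of uv).
Proof.
apply/span_classP; rewrite /span_comp.
case: constructive_indefinite_description => q /= [P' [u' [v' [uv' ->]]]].
have es := span_class_repr s; have er := span_class_repr r.
apply: span_le_antisym; apply: span_comp_of_le; apply: span_equiv_le => //.
  exact: span_equiv_sym.
exact: span_equiv_sym.
Qed.

Lemma partial_tensE (X X' Y Y' : C) (s : span X X') (r : span Y Y') :
  partial_tens (span_class s) (span_class r) = span_class (span_tens s r).
Proof.
have le (s1 s2 : span X X') (r1 r2 : span Y Y') : span_le_rep s1 s2 ->
    span_le_rep r1 r2 -> span_le_rep (span_tens s1 r1) (span_tens s2 r2).
  move=> [t [e1 e2]] [k [e3 e4]]; exists (t ⊗ k).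
  by rewrite /= -e1 -e2 -e3 -e4 !(tens_comp smC).
have es := span_class_repr s; have er := span_class_repr r.
apply/span_classP; apply: span_le_antisym; apply: le; apply: span_equiv_le => //.
  exact: span_equiv_sym.
exact: span_equiv_sym.
Qed.

End Partial.

(* Main.v *)
Require Import Defs.
From Corelib Require Import ssreflect.

Set Implicit Arguments.
Unset Strict Implicit.
Unset Printing Implicit Defensive.

(** The hom-sets of [Partial hC] are computed with explicit spans, and each
    composite is read off from one explicit pullback square
    ([partial_comp_pullback]).  Three families of squares are used.

    - Squares that are pullbacks in any category: those with an invertible
      side, and the two pastings that give associativity.  They make
      [partial_incl] a functor that preserves tensor products, so that every
      coherence equation of a CD category, being an equation between images of
      morphisms of [C], holds in [Partial hC] because it holds in [C];
      naturality of the structure isomorphisms is [partial_natural].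

    - Tensor products of two pullback squares ([pullback_tens]), which make the
      tensor product of partial maps functorial.  The point is that a morphism
      into [A ⊠ B] whose first marginal lands in a deterministic subobject [P]
      of [A] lands in [P ⊠ B] ([factor_left]): pulling back [P] along the
      projection gives a deterministic inclusion [q], and a deterministic
      morphism into [A ⊠ B] is the pairing of its marginals, so that [q]
      factors through [P ⊠ B].

    - The preimage under [copy X] of the tensor product of two deterministic
      subobjects of [X], which is their intersection ([pullback_copy]).

    By the last one, restricting [u = (A, i, f)] to the domain of definition of
    [v = (B, j, g)] gives [(A ∩ B, _, f)] ([partial_restrict]).  This is [v]
    exactly when [B] is contained in [A] and [g] is the restriction of [f],
    that is, when [u] is above [v] in the span order.  Quasi-totality of [u]
    says that [u] extends itself, so it is reflexivity of the span order.
    Finally [del ∘ (A, i, f) = (A, i, del)] is [del] exactly when [i] is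
    invertible, that is, when [(A, i, f)] is equivalent to a span with an
    identity leg. *)

(** * Marginals in a Markov category *)

Section Marginals.
Context {C : cd_data} (mC : is_markov C).

Let cdC : is_cd C := proj1 mC.
Let smC : is_symmetric_monoidal C := cd_symmetric_monoidal cdC.
Let catC : is_category C := sm_category smC.

Definition marg_l (X Y : C) : hom (X ⊠ Y) X := runit X ∘ (idm X ⊗ del Y).
Definition marg_r (X Y : C) : hom (X ⊠ Y) Y := lunit Y ∘ (del X ⊗ idm Y).

Lemma marg_l_tens (X X' Y Y' : C) (f : hom X X') (g : hom Y Y') :
  marg_l X' Y' ∘ (f ⊗ g) = f ∘ marg_l X Y.
Proof.
rewrite /marg_l -(compA catC) -(tens_comp smC) (comp1f catC) (proj2 mC _ _ g).
rewrite (compA catC) -(runit_nat smC) -(compA catC) -(tens_comp smC).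
by rewrite (compf1 catC) (comp1f catC).
Qed.

Lemma marg_r_tens (X X' Y Y' : C) (f : hom X X') (g : hom Y Y') :
  marg_r X' Y' ∘ (f ⊗ g) = g ∘ marg_r X Y.
Proof.
rewrite /marg_r -(compA catC) -(tens_comp smC) (comp1f catC) (proj2 mC _ _ f).
rewrite (compA catC) -(lunit_nat smC) -(compA catC) -(tens_comp smC).
by rewrite (compf1 catC) (comp1f catC).
Qed.

Lemma marg_l_tens_comp (W X X' Y Y' : C) (f : hom X X') (g : hom Y Y')
    (a : hom W (X ⊠ Y)) :
  marg_l X' Y' ∘ ((f ⊗ g) ∘ a) = f ∘ (marg_l X Y ∘ a).
Proof. by rewrite (compA catC (marg_l X' Y')) marg_l_tens -(compA catC). Qed.

Lemma marg_l_copy (X : C) : marg_l X X ∘ copy X = idm X.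
Proof. exact: copy_runit cdC X. Qed.

Lemma marg_r_tens_comp (W X X' Y Y' : C) (f : hom X X') (g : hom Y Y')
    (a : hom W (X ⊠ Y)) :
  marg_r X' Y' ∘ ((f ⊗ g) ∘ a) = g ∘ (marg_r X Y ∘ a).
Proof. by rewrite (compA catC (marg_r X' Y')) marg_r_tens -(compA catC). Qed.

Lemma marg_r_copy (X : C) : marg_r X X ∘ copy X = idm X.
Proof. exact: copy_lunit cdC X. Qed.

(** Commutativity of the comultiplication of the unit object gives this
    directly, since that comultiplication is invertible. *)
Lemma braid_unit : braid (@munit C) munit = idm (munit ⊠ munit).
Proof.
have := copy_comm cdC (@munit C); rewrite (copy_unit cdC).
move=> /(f_equal (fun h => h ∘ lunit _)).
by rewrite -(compA catC) (lunitK smC) (compf1 catC).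
Qed.

Lemma middle_swap_unit (X Y : C) :
  middle_swap X munit munit Y = idm ((X ⊠ munit) ⊠ (munit ⊠ Y)).
Proof.
rewrite /middle_swap braid_unit (tens_id smC) (compf1 catC) (assoc_invK smC).
by rewrite (tens_id smC) (compf1 catC) (assocK smC).
Qed.

End Marginals.

Section DetMarginals.
Context {C : cd_data} (hC : partializable C).

Let mC : is_markov C := pz_markov hC.
Let cdC : is_cd C := proj1 mC.
Let smC : is_symmetric_monoidal C := cd_symmetric_monoidal cdC.
Let catC : is_category C := sm_category smC.

(** Naturality of the middle swap moves the two deletions in front of it, where
    it becomes a swap of two unit objects. *)
Lemma marg_copy (X Y : C) :
  (marg_l X Y ⊗ marg_r X Y) ∘ copy (X ⊠ Y) = idm (X ⊠ Y).
Proof.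
rewrite (copy_tens cdC) (compA catC) /marg_l /marg_r (tens_comp smC).
rewrite -(compA catC (runit X ⊗ lunit Y)) -(middle_swap_nat hC).
rewrite (middle_swap_unit mC) (comp1f catC) -(tens_comp smC) -(tens_comp smC).
by rewrite (copy_runit cdC) (copy_lunit cdC) (tens_id smC).
Qed.

Lemma det_pairing (W X Y : C) (q : hom W (X ⊠ Y)) : deterministic q ->
  ((marg_l X Y ∘ q) ⊗ (marg_r X Y ∘ q)) ∘ copy W = q.
Proof.
move=> [_ cq]; rewrite (tens_comp smC) -(compA catC) -cq (compA catC).
by rewrite marg_copy (comp1f catC).
Qed.

(** The pullback of [u] along the projection is a subobject [q] through which
    [a] factors.  As [q] is deterministic it is the pairing of its marginals,
    and the first of them goes through [u]. *)
Lemma factor_left (W A B P : C) (u : hom P A) (a : hom W (A ⊠ B))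
    (w : hom W P) : det_mono u -> marg_l A B ∘ a = u ∘ w ->
  exists c : hom W (P ⊠ B), (u ⊗ idm B) ∘ c = a.
Proof.
move=> du e; have [Q [q [r pb]]] := pz_pullback hC (marg_l A B) du.
have [dq _] := pz_pullback_det_mono hC du pb.
have [z [[<- _] _]] := proj2 pb _ _ _ e.
exists ((r ⊗ (marg_r A B ∘ q)) ∘ copy Q ∘ z).
rewrite !(compA catC) -(tens_comp smC) (comp1f catC) -(proj1 pb).
by rewrite (det_pairing dq).
Qed.

Lemma factor_right (W A B P : C) (u : hom P B) (a : hom W (A ⊠ B))
    (w : hom W P) : det_mono u -> marg_r A B ∘ a = u ∘ w ->
  exists c : hom W (A ⊠ P), (idm A ⊗ u) ∘ c = a.
Proof.
move=> du e; have [Q [q [r pb]]] := pz_pullback hC (marg_r A B) du.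
have [dq _] := pz_pullback_det_mono hC du pb.
have [z [[<- _] _]] := proj2 pb _ _ _ e.
exists (((marg_l A B ∘ q) ⊗ r) ∘ copy Q ∘ z).
rewrite !(compA catC) -(tens_comp smC) (comp1f catC) -(proj1 pb).
by rewrite (det_pairing dq).
Qed.

End DetMarginals.

(** * Pullbacks along monomorphisms *)

Section Pullbacks.
Context {C : category_data} (catC : is_category C).

(** When the vertical sides are monic, only the factorization of the left
    component of a cone has to be found. *)
Lemma mono_pullback (A B Y P : C) (f : hom A Y) (j : hom B Y)
    (u : hom P A) (v : hom P B) :
  monomorphism j -> monomorphism u -> f ∘ u = j ∘ v ->
  (forall (W : C) (a : hom W A) (b : hom W B), f ∘ a = j ∘ b ->
    exists w : hom W P, u ∘ w = a) ->
  is_pullback f j u v.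
Proof.
move=> mj mu e fac; split=> // W a b eab.
have [w wa] := fac W a b eab; exists w; split=> [|w' [w'a _]].
  by split=> //; apply: mj; rewrite (compA catC) -e -(compA catC) wa.
by apply: mu; rewrite wa.
Qed.

Lemma iso_mono (X Y : C) (f : hom X Y) : is_iso f -> monomorphism f.
Proof.
move=> [g [gf _]] W a b /(f_equal (comp g)).
by rewrite !(compA catC) gf !(comp1f catC).
Qed.

Lemma iso_pullback (A B Y P : C) (f : hom A Y) (j : hom B Y)
    (u : hom P A) (v : hom P B) :
  monomorphism f -> monomorphism j -> is_iso v -> f ∘ u = j ∘ v ->
  is_pullback f j u v.
Proof.
move=> mf mj [v' [v'v vv']] e.
have fac (W : C) (a : hom W A) (b : hom W B) : f ∘ a = j ∘ b ->
    u ∘ (v' ∘ b) = a.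
  move=> eab; apply: mf; rewrite eab !(compA catC) e -(compA catC j) vv'.
  by rewrite (compf1 catC).
apply: mono_pullback => // W a b eab; last by eexists; exact: fac eab.
have mv : monomorphism v by apply: iso_mono; exists v'.
by apply: mv; apply: mj; rewrite !(compA catC) -e -!(compA catC) eab.
Qed.

Lemma pullback_id (A Y : C) (f : hom A Y) :
  is_pullback f (idm Y) (idm A) f.
Proof.
apply: mono_pullback; last by move=> W a b _; exists a; rewrite (comp1f catC).
- by move=> W a b; rewrite !(comp1f catC).
- by move=> W a b; rewrite !(comp1f catC).
- by rewrite (compf1 catC) (comp1f catC).
Qed.

Lemma id_pullback (B Y : C) (j : hom B Y) : monomorphism j ->
  is_pullback (idm Y) j j (idm B).
Proof.
move=> mj; apply: iso_pullback => //.
- by move=> W a b; rewrite !(comp1f catC).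
- by exists (idm B); rewrite (comp1f catC).
- by rewrite (compf1 catC) (comp1f catC).
Qed.

Section Pasting.
Context (A B D Y Z P Q R : C).
Context (f : hom A Y) (j : hom B Y) (u : hom P A) (v : hom P B).
Context (g : hom B Z) (k : hom D Z) (s : hom Q B) (t : hom Q D).
Context (m : hom R P) (n : hom R Q).
Hypotheses (mj : monomorphism j) (mu : monomorphism u) (mk : monomorphism k).
Hypotheses (ms : monomorphism s) (mm : monomorphism m).
Hypotheses (pbP : is_pullback f j u v) (pbQ : is_pullback g k s t).
Hypothesis pbR : is_pullback v s m n.

Lemma pullback_paste_right : is_pullback (g ∘ v) k m (t ∘ n).
Proof.
apply: mono_pullback => // [|W a b].
  by rewrite -(compA catC) (proj1 pbR) !(compA catC) (proj1 pbQ).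
rewrite -(compA catC) => /(proj2 pbQ) [x [[sx _] _]].
by have [w [[wa _] _]] := proj2 pbR _ _ _ (eq_sym sx); exists w.
Qed.

Lemma pullback_paste_left : is_pullback f (j ∘ s) (u ∘ m) n.
Proof.
apply: mono_pullback.
- by move=> W a b; rewrite -!(compA catC) => /mj /ms.
- by move=> W a b; rewrite -!(compA catC) => /mu /mm.
- by rewrite (compA catC) (proj1 pbP) -!(compA catC) (proj1 pbR).
- move=> W a b; rewrite -(compA catC) => /(proj2 pbP) [x [[ux vx] _]].
  have [w [[mw _] _]] := proj2 pbR _ _ _ vx.
  by exists w; rewrite -(compA catC) mw.
Qed.

End Pasting.
End Pullbacks.

Section MonoidalPullbacks.
Context {C : cd_data} (hC : partializable C).

Let mC : is_markov C := pz_markov hC.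
Let cdC : is_cd C := proj1 mC.
Let smC : is_symmetric_monoidal C := cd_symmetric_monoidal cdC.
Let catC : is_category C := sm_category smC.

(** The marginals of a cone over the tensor square are cones over the two
    factors, so that each marginal lands in the corresponding subobject. *)
Lemma pullback_tens (A B Y P A' B' Y' P' : C)
    (f : hom A Y) (j : hom B Y) (u : hom P A) (v : hom P B)
    (f' : hom A' Y') (j' : hom B' Y') (u' : hom P' A') (v' : hom P' B') :
  det_mono j -> det_mono j' ->
  is_pullback f j u v -> is_pullback f' j' u' v' ->
  is_pullback (f ⊗ f') (j ⊗ j') (u ⊗ u') (v ⊗ v').
Proof.
move=> dj dj' pb pb'.
have du := pz_pullback_det_mono hC dj pb.
have du' := pz_pullback_det_mono hC dj' pb'.
apply: (mono_pullback catC).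
- exact: (proj2 (det_mono_tens hC dj dj')).
- exact: (proj2 (det_mono_tens hC du du')).
- by rewrite -!(tens_comp smC) (proj1 pb) (proj1 pb').
- move=> W a b e.
  have el : f ∘ (marg_l A A' ∘ a) = j ∘ (marg_l B B' ∘ b).
    by rewrite -(marg_l_tens_comp mC f f') e (marg_l_tens_comp mC).
  have er : f' ∘ (marg_r A A' ∘ a) = j' ∘ (marg_r B B' ∘ b).
    by rewrite -(marg_r_tens_comp mC f f') e (marg_r_tens_comp mC).
  have [w [[wl _] _]] := proj2 pb _ _ _ el.
  have [w' [[wr _] _]] := proj2 pb' _ _ _ er.
  have [c ca] := factor_left hC du (eq_sym wl).
  have rc : marg_r P A' ∘ c = u' ∘ w'.
    by rewrite wr -ca (marg_r_tens_comp mC) (comp1f catC).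
  have [d dc] := factor_right hC du' rc.
  by exists d; rewrite -ca -dc (compA catC) -(tens_comp smC) (compf1 catC)
    (comp1f catC).
Qed.

(** The marginals of [copy X ∘ a] are both [a]; if they land in [A] and in [B]
    respectively, then [a] lands in the intersection. *)
Lemma pullback_copy (X A B P : C) (i : hom A X) (j : hom B X)
    (p : hom P A) (q : hom P B) :
  det_mono i -> det_mono j -> is_pullback i j p q ->
  is_pullback (copy X) (i ⊗ j) (i ∘ p) ((p ⊗ q) ∘ copy P).
Proof.
move=> di dj pb.
have dip := det_mono_comp hC di (pz_pullback_det_mono hC dj pb).
apply: (mono_pullback catC).
- exact: (proj2 (det_mono_tens hC di dj)).
- exact: (proj2 dip).
- rewrite (compA catC (i ⊗ j)) -(tens_comp smC) -(proj1 pb).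
  exact: (proj2 (proj1 dip)).
- move=> W a b e.
  have al : a = i ∘ (marg_l A B ∘ b).
    rewrite -(marg_l_tens_comp mC i j) -e (compA catC (marg_l X X)).
    by rewrite (marg_l_copy mC) (comp1f catC).
  have ar : a = j ∘ (marg_r A B ∘ b).
    rewrite -(marg_r_tens_comp mC i j) -e (compA catC (marg_r X X)).
    by rewrite (marg_r_copy mC) (comp1f catC).
  have eb : i ∘ (marg_l A B ∘ b) = j ∘ (marg_r A B ∘ b) by rewrite -al -ar.
  have [w [[pw _] _]] := proj2 pb _ _ _ eb.
  by exists w; rewrite -(compA catC) pw -al.
Qed.

End MonoidalPullbacks.

(** * Calculus of partial maps *)

Section PartialCalculus.
Context {C : cd_data} (hC : partializable C).

Let mC : is_markov C := pz_markov hC.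
Let cdC : is_cd C := proj1 mC.
Let smC : is_symmetric_monoidal C := cd_symmetric_monoidal cdC.
Let catC : is_category C := sm_category smC.

Local Notation PC := (Partial hC).
Local Notation incl f := (partial_incl hC f).

Lemma partial_hom_ind (X Y : C) (T : partial_hom X Y -> Prop) :
  (forall s : span X Y, T (span_class s)) -> forall u, T u.
Proof. by move=> h u; rewrite -(span_reprK u). Qed.

Lemma span_equivI (X Y : C) (s s' : span X Y)
    (t : hom (apex s) (apex s')) :
  is_iso t -> leg s' ∘ t = leg s -> mor s' ∘ t = mor s ->
  span_class s = span_class s'.
Proof. by move=> it el em; apply/(span_classP hC); exists t. Qed.

Lemma iso_id (X : C) : is_iso (idm X).
Proof. by exists (idm X); rewrite (comp1f catC). Qed.

Lemma span_class_ext (X Y D : C) (i i' : hom D X) (f f' : hom D Y)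
    (d : det_mono i) (d' : det_mono i') :
  i = i' -> f = f' ->
  span_class (Span D i f d) = span_class (Span D i' f' d').
Proof.
move=> ei ef; apply: (@span_equivI _ _ (Span _ _ _ _) (Span _ _ _ _) (idm D)).
- exact: iso_id.
- by rewrite /= (compf1 catC).
- by rewrite /= (compf1 catC).
Qed.

(** Unlike [partial_compE], this leaves the result free to be given by any
    morphisms equal to the two composites. *)
Lemma partial_comp_pullback (X Y Z : C) (r : span Y Z) (s : span X Y)
    (q : span X Z) (u : hom (apex q) (apex s)) (v : hom (apex q) (apex r)) :
  is_pullback (mor s) (leg r) u v -> leg s ∘ u = leg q -> mor r ∘ v = mor q ->
  @comp PC X Y Z (span_class r) (span_class s) = span_class q.
Proof.
case: q u v => D k h dk u v uv el em.
by rewrite /= (partial_compE hC uv); exact: span_class_ext.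
Qed.

Lemma partial_incl_comp (X Y Z : C) (g : hom Y Z) (s : span X Y) :
  @comp PC X Y Z (incl g) (span_class s)
  = span_class (Span (apex s) (leg s) (g ∘ mor s) (leg_det_mono s)).
Proof.
apply: (partial_comp_pullback (q := Span _ _ _ _)) => /=.
- exact: pullback_id.
- exact: (compf1 catC).
- by [].
Qed.

Lemma incl_comp (X Y Z : C) (g : hom Y Z) (f : hom X Y) :
  @comp PC X Y Z (incl g) (incl f) = incl (g ∘ f).
Proof. exact: partial_incl_comp. Qed.

Lemma partial_tens_class (X X' Y Y' : C) (s : span X X') (r : span Y Y') :
  @tens PC X X' Y Y' (span_class s) (span_class r)
  = span_class (span_tens hC s r).
Proof. exact: partial_tensE. Qed.

Lemma incl_tens (X X' Y Y' : C) (f : hom X X') (g : hom Y Y') :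
  @tens PC X X' Y Y' (incl f) (incl g) = incl (f ⊗ g).
Proof.
rewrite partial_tens_class.
by apply: span_class_ext; rewrite //= (tens_id smC).
Qed.

(** A morphism of spans over [a] and [c] whose middle component is invertible
    exhibits the left square as a pullback. *)
Lemma partial_natural (X X' Y Y' : C) (a : hom X X') (c : hom Y Y')
    (s : span X Y) (s' : span X' Y') (b : hom (apex s) (apex s')) :
  is_iso a -> is_iso b -> a ∘ leg s = leg s' ∘ b -> c ∘ mor s = mor s' ∘ b ->
  @comp PC X Y Y' (incl c) (span_class s)
  = @comp PC X X' Y' (span_class s') (incl a).
Proof.
move=> ia ib el em; rewrite partial_incl_comp.
symmetry; apply: (partial_comp_pullback (q := Span _ _ _ _)) => /=.
- apply: (iso_pullback catC _ _ ib el); first exact: iso_mono.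
  exact: (proj2 (leg_det_mono s')).
- exact: (comp1f catC).
- by rewrite em.
Qed.

(** ** The laws of a CD category *)

Lemma partial_category : is_category PC.
Proof.
split.
- move=> X Y f; elim/partial_hom_ind: f => [[D i f d]].
  rewrite partial_incl_comp; apply: span_class_ext => //=.
  exact: (comp1f catC).
- move=> X Y f; elim/partial_hom_ind: f => s.
  apply: (@partial_comp_pullback X X Y s
    (@Span C X X X _ _ (det_mono_id hC X)) s (leg s) (idm (apex s))) => /=.
  + exact/id_pullback/(proj2 (leg_det_mono s)).
  + exact: (comp1f catC).
  + exact: (compf1 catC).
- move=> W X Y Z h g f.
  elim/partial_hom_ind: h => [[D k h dk]].
  elim/partial_hom_ind: g => [[B j g dj]].
  elim/partial_hom_ind: f => [[A i f di]].
  have [P [u [v pbP]]] := pz_pullback hC f dj.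
  have [Q [s [t pbQ]]] := pz_pullback hC g dk.
  have du := pz_pullback_det_mono hC dj pbP.
  have ds := pz_pullback_det_mono hC dk pbQ.
  have [R [m [n pbR]]] := pz_pullback hC v ds.
  have dm := pz_pullback_det_mono hC ds pbR.
  have diu := det_mono_comp hC di du.
  have djs := det_mono_comp hC dj ds.
  have dium := det_mono_comp hC diu dm.
  rewrite (partial_comp_pullback (r := Span B j g dj) (s := Span A i f di)
    (q := Span P (i ∘ u) (g ∘ v) diu) pbP) //.
  rewrite (partial_comp_pullback (r := Span D k h dk) (s := Span B j g dj)
    (q := Span Q (j ∘ s) (h ∘ t) djs) pbQ) //.
  have pbl := pullback_paste_right catC (proj2 dk) (proj2 dm) pbQ pbR.
  have pbr := pullback_paste_left catC (proj2 dj) (proj2 du) (proj2 ds)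
    (proj2 dm) pbP pbR.
  rewrite (partial_comp_pullback (q := Span R (i ∘ u ∘ m) (h ∘ t ∘ n) dium)
    (r := Span D k h dk) (s := Span P (i ∘ u) (g ∘ v) diu) pbl) //.
  by rewrite /= (compA catC).
  rewrite (partial_comp_pullback (q := Span R (i ∘ u ∘ m) (h ∘ t ∘ n) dium)
    (r := Span Q (j ∘ s) (h ∘ t) djs) (s := Span A i f di) pbr) //.
  by rewrite /= (compA catC).
Qed.

Lemma partial_tens_comp (X Y Z X' Y' Z' : C) (g : partial_hom Y Z)
    (f : partial_hom X Y) (g' : partial_hom Y' Z') (f' : partial_hom X' Y') :
  @tens PC X Z X' Z' (@comp PC X Y Z g f) (@comp PC X' Y' Z' g' f')
  = @comp PC _ _ _ (@tens PC _ _ _ _ g g') (@tens PC _ _ _ _ f f').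
Proof.
elim/partial_hom_ind: g => r; elim/partial_hom_ind: f => s.
elim/partial_hom_ind: g' => r'; elim/partial_hom_ind: f' => s'.
have [P [u [v pb]]] := pz_pullback hC (mor s) (leg_det_mono r).
have [P' [u' [v' pb']]] := pz_pullback hC (mor s') (leg_det_mono r').
rewrite (partial_comp_pullback (q := span_comp_of hC pb) pb) //.
rewrite (partial_comp_pullback (q := span_comp_of hC pb') pb') //.
rewrite !partial_tens_class.
symmetry; apply: (partial_comp_pullback (r := span_tens hC r r')
  (s := span_tens hC s s')
  (q := span_tens hC (span_comp_of hC pb) (span_comp_of hC pb'))
  (u := u ⊗ u') (v := v ⊗ v')).
- exact: (pullback_tens hC (leg_det_mono r) (leg_det_mono r') pb pb').
- by rewrite /= -(tens_comp smC).
- by rewrite /= -(tens_comp smC).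
Qed.

Lemma partial_symmetric_monoidal : is_symmetric_monoidal PC.
Proof.
have iso_assoc (X Y Z : C) : is_iso (assoc X Y Z).
  by exists (assoc_inv X Y Z); rewrite (assocK smC) (assoc_invK smC).
have iso_lunit (X : C) : is_iso (lunit X).
  by exists (lunit_inv X); rewrite (lunitK smC) (lunit_invK smC).
have iso_runit (X : C) : is_iso (runit X).
  by exists (runit_inv X); rewrite (runitK smC) (runit_invK smC).
have iso_braid (X Y : C) : is_iso (braid X Y).
  by exists (braid Y X); rewrite !(braidK smC).
pose id_unit := Span munit (idm munit) (idm munit) (det_mono_id hC munit).
split.
- exact: partial_category.
- by move=> X Y; rewrite incl_tens (tens_id smC).
- exact: partial_tens_comp.
- by move=> X Y Z; rewrite incl_comp (assocK smC).
- by move=> X Y Z; rewrite incl_comp (assoc_invK smC).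
- by move=> X; rewrite incl_comp (lunitK smC).
- by move=> X; rewrite incl_comp (lunit_invK smC).
- by move=> X; rewrite incl_comp (runitK smC).
- by move=> X; rewrite incl_comp (runit_invK smC).
- move=> X X' Y Y' Z Z' f g h.
  elim/partial_hom_ind: f => f; elim/partial_hom_ind: g => g.
  elim/partial_hom_ind: h => h; rewrite !partial_tens_class.
  exact: (partial_natural (s := span_tens hC (span_tens hC f g) h)
    (s' := span_tens hC f (span_tens hC g h))
    (iso_assoc _ _ _) (iso_assoc _ _ _)
    (assoc_nat smC (leg f) (leg g) (leg h))
    (assoc_nat smC (mor f) (mor g) (mor h))).
- move=> X Y f; elim/partial_hom_ind: f => f.
  rewrite partial_tens_class.
  exact: (partial_natural (s := span_tens hC id_unit f) (s' := f) (iso_lunit _)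
    (iso_lunit _) (lunit_nat smC (leg f)) (lunit_nat smC (mor f))).
- move=> X Y f; elim/partial_hom_ind: f => f.
  rewrite partial_tens_class.
  exact: (partial_natural (s := span_tens hC f id_unit) (s' := f) (iso_runit _)
    (iso_runit _) (runit_nat smC (leg f)) (runit_nat smC (mor f))).
- move=> X X' Y Y' f g.
  elim/partial_hom_ind: f => f; elim/partial_hom_ind: g => g.
  rewrite !partial_tens_class.
  exact: (partial_natural (s := span_tens hC f g) (s' := span_tens hC g f)
    (iso_braid _ _) (iso_braid _ _)
    (braid_nat smC (leg f) (leg g)) (braid_nat smC (mor f) (mor g))).
- by move=> X Y; rewrite incl_comp (braidK smC).
- by move=> X Y; rewrite !incl_tens incl_comp (triangle smC).
- by move=> W X Y Z; rewrite !incl_tens !incl_comp (pentagon smC).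
- by move=> X Y Z; rewrite !incl_tens !incl_comp (hexagon smC).
Qed.

Lemma partial_cd : is_cd PC.
Proof.
split.
- exact: partial_symmetric_monoidal.
- by move=> X; rewrite !incl_tens !incl_comp (copy_assoc cdC).
- by move=> X; rewrite !incl_tens !incl_comp (copy_lunit cdC).
- by move=> X; rewrite !incl_tens !incl_comp (copy_runit cdC).
- by move=> X; rewrite incl_comp (copy_comm cdC).
- move=> X Y; rewrite /middle_swap !incl_tens !incl_comp incl_tens !incl_comp.
  by rewrite /= (copy_tens cdC).
- by move=> X Y; rewrite !incl_tens !incl_comp /= (del_tens cdC).
- by rewrite /= (copy_unit cdC).
- by rewrite /= (del_unit cdC).
Qed.

(** ** Extension and totality *)

Lemma partial_del_comp (X Y : C) (s : span X Y) :
  @comp PC X Y munit (@del PC Y) (span_class s)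
  = span_class (Span (apex s) (leg s) (del (apex s)) (leg_det_mono s)).
Proof. by rewrite partial_incl_comp (proj2 mC _ _ (mor s)). Qed.

(** Copying turns the domain of [s ⊗ r] into the intersection of the two
    domains; the second output, being deleted, leaves only its domain behind. *)
Lemma partial_restrict (X Y : C) (s r : span X Y) (P : C)
    (p : hom P (apex s)) (q : hom P (apex r)) (d : det_mono (leg s ∘ p)) :
  is_pullback (leg s) (leg r) p q ->
  @comp PC _ _ _ (@comp PC _ _ _ (@runit PC Y)
    (@tens PC _ _ _ _ (span_class s)
      (@comp PC _ _ _ (@del PC Y) (span_class r)))) (@copy PC X)
  = span_class (Span P (leg s ∘ p) (mor s ∘ p) d).
Proof.
move=> pb; rewrite partial_del_comp partial_tens_class partial_incl_comp.
have pbc := pullback_copy hC (leg_det_mono s) (leg_det_mono r) pb.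
apply: (partial_comp_pullback (r := Span _ _ _ _)
  (s := Span _ _ _ (det_mono_id hC X)) (q := Span _ _ _ d) pbc) => /=.
  exact: (comp1f catC).
(* Everything is total in [C], so [r] may be replaced by a second copy of the
   restriction of [s], whose left marginal is that restriction. *)
have e : (mor s ⊗ del (apex r)) ∘ (p ⊗ q)
    = (idm Y ⊗ del Y) ∘ ((mor s ∘ p) ⊗ (mor s ∘ p)).
  by rewrite -!(tens_comp smC) (comp1f catC) (proj2 mC _ _ q) (proj2 mC).
rewrite !(compA catC) -(compA catC (runit Y)) e !(compA catC (runit Y)).
rewrite -/(marg_l Y Y) (marg_l_tens mC).
by rewrite -(compA catC) (marg_l_copy mC) (compf1 catC).
Qed.

(** If the restriction of [s] to the intersection with [r] is [r], the
    intersection is all of [r], whence the inclusion of [r] into [s]; conversely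
    an inclusion of [r] into [s] exhibits [r] as the intersection. *)
Lemma partial_extendsE (X Y : C) (u v : @hom PC X Y) :
  extends u v <-> span_ge u v.
Proof.
elim/partial_hom_ind: u => s; elim/partial_hom_ind: v => r.
rewrite (span_geE hC) /extends; split.
- have [P [p [q pb]]] := pz_pullback hC (leg s) (leg_det_mono r).
  have d := det_mono_comp hC (leg_det_mono s)
    (pz_pullback_det_mono hC (leg_det_mono r) pb).
  rewrite (partial_restrict d pb) => /(span_classP hC)/(span_equiv_sym hC).
  move=> /span_equiv_le [t [el em]].
  by exists (p ∘ t); rewrite !(compA catC).
- move=> [t [el em]].
  have pb : is_pullback (leg s) (leg r) t (idm _).
    apply: (iso_pullback catC _ _ (iso_id _)); last by rewrite (compf1 catC).
      exact: (proj2 (leg_det_mono s)).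
    exact: (proj2 (leg_det_mono r)).
  have d : det_mono (leg s ∘ t) by rewrite el; exact: leg_det_mono.
  by rewrite (partial_restrict d pb); case: r t el em pb d => *;
    exact: span_class_ext.
Qed.

Lemma partial_quasi_total (X Y : C) (u : @hom PC X Y) : quasi_total u.
Proof.
apply/(partial_extendsE u u); elim/partial_hom_ind: u => s.
by apply/(span_geE hC)/span_equiv_le/(span_equiv_refl hC).
Qed.

(** The equivalence of [(A, i, del)] with [(X, id, del)] is an isomorphism that
    can only be [i] itself. *)
Lemma partial_totalE (X Y : C) (u : @hom PC X Y) :
  total u <-> exists f : @hom C X Y, u = incl f.
Proof.
split; last first.
  by move=> [f ->]; rewrite /total incl_comp (proj2 mC _ _ f).
elim/partial_hom_ind: u => s; rewrite /total partial_del_comp.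
move=> /(span_classP hC) [t /= [it [et _]]].
have il : is_iso (leg s) by rewrite -et (comp1f catC).
have [l [ll _]] := il.
exists (mor s ∘ l).
apply: (span_equivI (s' := Span _ (idm _) (mor s ∘ l) _) (t := leg s)) => //=.
  exact: (comp1f catC).
by rewrite -(compA catC) ll (compf1 catC).
Qed.

End PartialCalculus.

Theorem corollary1p7 (C : cd_data) (hC : partializable C) :
  is_quasi_markov (Partial hC) /\
  (forall (X Y : Partial hC) (u v : hom X Y), extends u v <-> span_ge u v) /\
  (forall (X Y : Partial hC) (u : hom X Y),
    total u <-> exists f : @hom C X Y, u = partial_incl hC f).
Proof.
split; [split|split].
- exact: partial_cd.
- move=> X Y u; exact: partial_quasi_total.
- move=> X Y u v; exact: partial_extendsE.
- move=> X Y u; exact: partial_totalE.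
Qed.
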